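(* Let $u\in S_n$ and let $x\in G^{u,w_{\mathrm o}}$ be factored as $x=x_-\cdot x^{(n-1)}x^{(n-2)}\cdots x^{(1)}$, where $x_-\in G^{u,e}$ and, for each $m\in[1,n-1]$, $$x^{(m)}=x_m(t_{m,m})\,x_{m+1}(t_{m,m+1})\cdots x_{n-1}(t_{m,n-1})$$ with all $t_{m,k}$ nonzero elements of $\mathcal F$. Then $$t_{m,k}=\Delta^{m,k}_{[1,m],[k-m+1,k]}(x)^{-1}\,\Delta^{m,k+1}_{[1,m],[k-m+2,k+1]}(x)$$ for all $1\le m\le k\le n-1$.
   Context: Let $\mathcal F$ be a skew field, $G=GL_n(\mathcal F)$, $[a,b]=\{a,a+1,\dots,b\}$ (empty if $a>b$). $B$ (resp. $B^-$) is the group of upper (resp. lower) triangular matrices in $G$; $S_n$ is embedded in $G$ as permutation matrices ($ue_k=e_{u(k)}$); $e$ is the identity permutation and $w_{\mathrm o}=(n,n-1,\dots,1)$ the longest permutation. The double Bruhat cell is $G^{u,v}=BuB\cap B^-vB^-$. For $i\in[1,n-1]$, $x_i(t)=I+tE_{i,i+1}$, $E_{i,i+1}$ a matrix unit. Quasideterminants: for a square matrix $A=(a_{ij})_{i\in I,j\in J}$, $|A|_{ij}=a_{ij}$ if $|I|=1$; otherwise, if $A^{ij}$ ($A$ with row $i$ and column $j$ deleted) is invertible, $|A|_{ij}=a_{ij}-r_i(A^{ij})^{-1}c_j$, where $r_i$ is row $i$ of $A$ without $a_{ij}$ and $c_j$ is column $j$ of $A$ without $a_{ij}$. Positive quasiminors: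 for $I,J\subset[1,n]$ with $|I|=|J|$, $i\in I$, $j\in J$, $\Delta^{i,j}_{I,J}(x)=(-1)^{d_i(I)+d_j(J)}|x_{I,J}|_{i,j}$, where $x_{I,J}$ is the submatrix with rows $I$ and columns $J$, and $d_i(I)$ (resp. $d_j(J)$) is the number of elements of $I$ greater than $i$ (resp. of $J$ greater than $j$). *)

(* Defs.v *)
From HB Require Import structures.
From mathcomp Require Import all_boot all_order all_algebra all_fingroup.
From mathcomp Require classical_sets.

Set Implicit Arguments.
Unset Strict Implicit.
Unset Printing Implicit Defensive.

Import GRing.Theory.

Local Open Scope ring_scope.

(* The library's [unitmx] and [invmx] need a commutative base ring, so the    *)
(* inverse is taken by choice. Rectangular types occur because A^{ij} has     *)
(* rows and columns numbered by different index sets; [mx_inv A] is           *)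
(* meaningful only when [mx_invertible A].                                    *)
Section Inverse.
Variables (F : unitRingType) (p q : nat).
Implicit Type A : 'M[F]_(p, q).

Definition mx_inverse A (B : 'M[F]_(q, p)) : Prop :=
  A *m B = 1%:M /\ B *m A = 1%:M.

Definition mx_invertible A : Prop := exists B, mx_inverse A B.

Definition mx_inv A : 'M[F]_(q, p) := classical_sets.xget 0 (mx_inverse A).

End Inverse.

Section Quasideterminants.
Variables (F : unitRingType) (n : nat).
Implicit Types (x : 'M[F]_n) (I J : {set 'I_n}) (i j : 'I_n).

Definition submx_of x I J : 'M[F]_(#|I|, #|J|) :=
  \matrix_(a, b) x (enum_val a) (enum_val b).

Definition row_of x i J : 'rV[F]_(#|J|) := \row_b x i (enum_val b).

Definition col_of x I j : 'cV[F]_(#|I|) := \col_a x (enum_val a) j.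

(* |x_{I,J}|_{i,j}; the matrix product below is 1 x 1. *)
Definition quasidet x I J i j : F :=
  if #|I| == 1%N then x i j
  else x i j - (row_of x i (J :\ j) *m mx_inv (submx_of x (I :\ i) (J :\ j))
                  *m col_of x (I :\ i) j) ord0 ord0.

Definition quasidet_defined x I J i j : Prop :=
  [/\ i \in I, j \in J, #|I| = #|J|
    & #|I| = 1%N \/ mx_invertible (submx_of x (I :\ i) (J :\ j))].

Definition num_greater I i : nat := #|[set a in I | (i < a)%N]|.

Definition quasiminor x I J i j : F :=
  (-1) ^+ (num_greater I i + num_greater J j) * quasidet x I J i j.

End Quasideterminants.

Section DoubleBruhatCells.
Variables (F : unitRingType) (n : nat).
Implicit Types (x b : 'M[F]_n) (u v : 'S_n).

Definition lower_borel b : Prop := mx_invertible b /\ is_trig_mx b.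

Definition upper_borel b : Prop := mx_invertible b /\ is_trig_mx b^T.

(* Column convention u e_k = e_{u(k)}; [perm_mx u] is the transpose. *)
Definition perm_matrix u : 'M[F]_n := \matrix_(i, j) (i == u j)%:R.

Definition double_bruhat u v x : Prop :=
  (exists b1 b2, [/\ upper_borel b1, upper_borel b2
                   & x = b1 *m perm_matrix u *m b2])
  /\ (exists c1 c2, [/\ lower_borel c1, lower_borel c2
                      & x = c1 *m perm_matrix v *m c2]).

(* E_{i,j} for 1-based i and j, hence the [.+1] on ordinals. *)
Definition matrix_unit (i j : nat) : 'M[F]_n :=
  \matrix_(a, b) ((a.+1 == i) && (b.+1 == j))%:R.

Definition x_elem (i : nat) (t : F) : 'M[F]_n :=
  1%:M + t *: matrix_unit i i.+1.

(* x_m(t_{m,m}) x_{m+1}(t_{m,m+1}) ... x_{n-1}(t_{m,n-1}) *)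
Definition x_row (t : nat -> nat -> F) (m : nat) : 'M[F]_n :=
  \prod_(m <= k < n) x_elem k (t m k).

End DoubleBruhatCells.

Definition w_longest (n : nat) : 'S_n := perm (@rev_ord_inj n).

(* The interval [a, b] of 1-based indices, as a set of 0-based ordinals. *)
Definition itv1 (n a b : nat) : {set 'I_n} := [set i : 'I_n | a <= i.+1 <= b]%N.

(* Main.v *)
(* Each factor [x^(m)] is the inverse of a bidiagonal matrix, so column [k] of *)
(* [(x^(m-1) ... x^(1))^-1] is a vector [v] supported on the rows             *)
(* [k-m+1, k], with [v_k = 1]. The rows up to [m] of                          *)
(* [x^(n-1) ... x^(m+1)] are those of the identity and [x_-] is lower         *)
(* triangular, so the rows up to [m] of [x v] are those of                    *)
(* [(x_-)_{mm} (x^(m))_{mk} e_m]. Hence this coefficient is the quasiminor    *)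
(* [Delta^{m,k}_{[1,m],[k-m+1,k]}(x)]; being a unit, it gives, by induction   *)
(* on [m], the invertibility of the submatrices involved. Finally             *)
(* [(x^(m))_{mk} = t_{m,m} ... t_{m,k-1}], whence the ratio [t_{m,k}].        *)

Require Import Defs.
From HB Require Import structures.
From mathcomp Require Import all_boot all_order all_algebra all_fingroup.
From mathcomp Require Import zify.
From mathcomp Require classical_sets.

Import GRing.Theory.

Local Open Scope ring_scope.

(** A quasideterminant is a Schur complement, so it can be read off from one linear system. If
    $x_{I,J}v=s\,e_i$ with $v_j=1$ and $x_{I\setminus i,J\setminus j}$ is invertible, then
    $|x_{I,J}|_{ij}=s$ ([quasidet_witness_eq]); if moreover $s$ is a unit, $x_{I,J}$ is invertible
    too ([inverse_on_extend]). [fact_quasidet_witness] solves this system for all $m\le k$ with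
    $s=(x_-)_{mm}(x^{(m)})_{mk}$, a unit. Hence all submatrices involved are invertible
    ([fact_inverse_on]) and $s$ is the quasiminor ([fact_quasiminorE]). Replacing $k$ by $k+1$
    multiplies $s$ on the right by $t_{m,k}$ ([fact_quasidet_succ]), and the left quotient isolates
    it. *)

(** * Inverses of submatrices and Schur complements *)

Section SubmatrixInverse.

Set Implicit Arguments.
Unset Strict Implicit.

Variables (F : unitRingType) (n : nat).
Implicit Types (x B : 'M[F]_n) (I J : {set 'I_n}) (i j : 'I_n).

(** [B] keeps the full size $n$, and its entries outside $J\times I$ are arbitrary, so adjoining an
    index to $I$ and $J$ changes no type and needs no renumbering. *)
Definition inverse_on x I J B : Prop :=
  (forall i i', i \in I -> i' \in I ->
     \sum_(j in J) x i j * B j i' = (i == i')%:R) /\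
  (forall j j', j \in J -> j' \in J ->
     \sum_(i in I) B j i * x i j' = (j == j')%:R).

Lemma inverse_on_mx_inverse x I J B :
  inverse_on x I J B -> mx_inverse (submx_of x I J) (submx_of B J I).
Proof.
move=> [xB Bx]; split; apply/matrixP=> a b; rewrite !mxE.
- rewrite -(inj_eq enum_val_inj) -xB ?enum_valP // [RHS]big_enum_val.
  by apply: eq_bigr => c _; rewrite !mxE.
- rewrite -(inj_eq enum_val_inj) -Bx ?enum_valP // [RHS]big_enum_val.
  by apply: eq_bigr => c _; rewrite !mxE.
Qed.

(* The submatrix [x_{I,J}] sends [v] to [s e_i], and [v j = 1]: as soon as    *)
(* [x_{I \ i, J \ j}] is invertible this determines [s], which must be the    *)
(* Schur complement [|x_{I,J}|_{i,j}].                                        *)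
Definition quasidet_witness x I J i j (v : 'I_n -> F) (s : F) : Prop :=
  [/\ v j = 1, \sum_(l in J) x i l * v l = s
    & forall i', i' \in I :\ i -> \sum_(l in J) x i' l * v l = 0].

Lemma quasidet_witness_eq x I J i j B v s :
  i \in I -> j \in J -> #|I| = #|J| -> inverse_on x (I :\ i) (J :\ j) B ->
  quasidet_witness x I J i j v s -> quasidet x I J i j = s.
Proof.
move=> iI jJ IJ invB [vj vi vI]; rewrite /quasidet.
have sE : s = x i j + \sum_(l in J :\ j) x i l * v l.
  by rewrite -vi (big_setD1 j) //= vj mulr1.
case: ifP => [I1|_].
  have /eqP/setP J0 : J :\ j == set0.
    by rewrite -cards_eq0; move: I1; rewrite IJ (cardsD1 j) jJ.
  by rewrite sE big1 ?addr0 // => l; rewrite J0 inE.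
have [_ CA] : mx_inverse (submx_of x (I :\ i) (J :\ j))
                 (mx_inv (submx_of x (I :\ i) (J :\ j))).
  by apply: classical_sets.xgetPex; exists (submx_of B (J :\ j) (I :\ i));
    apply: inverse_on_mx_inverse.
set C := mx_inv _ in CA *.
pose v' : 'cV[F]_(#|J :\ j|) := \col_b v (enum_val b).
(* The rows other than [i] of $x_{I,J}v=s\,e_i$ express column [j] through the rest of [v];
   substituted in the Schur complement, this cancels the inverse. *)
have colE : col_of x (I :\ i) j = - (submx_of x (I :\ i) (J :\ j) *m v').
  apply/matrixP=> a b; rewrite !mxE; apply/eqP; rewrite -addr_eq0; apply/eqP.
  rewrite -[RHS](vI (enum_val a)) ?enum_valP // [RHS](big_setD1 j) //= vj mulr1.
  by congr (_ + _); rewrite [RHS]big_enum_val; apply: eq_bigr => c _; rewrite !mxE.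
rewrite colE -mulmxA mulmxN mulmxA CA mul1mx mulmxN !mxE opprK sE.
by congr (_ + _); rewrite [RHS]big_enum_val; apply: eq_bigr => c _; rewrite !mxE.
Qed.

(** Bordering: since $x_{I,J}v=s\,e_i$, column [i] of the new inverse is $v s^{-1}$. Any other
    column is that of [B], padded by 0 in row [j], minus the multiple of $v s^{-1}$ that kills its
    product [r] with row [i] of [x]. *)
Lemma inverse_on_extend x I J i j B v s :
  i \in I -> j \in J -> inverse_on x (I :\ i) (J :\ j) B ->
  quasidet_witness x I J i j v s -> s \is a GRing.unit ->
  exists B', inverse_on x I J B'.
Proof.
move=> iI jJ [xB Bx] [vj vi vI] Us.
pose w l := v l / s.
pose r i' := \sum_(l in J :\ j) x i l * B l i'.
pose B' : 'M[F]_n := \matrix_(l, i')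
  if i' == i then w l
  else (if l == j then 0 else B l i') - w l * r i'.
have B'i l : B' l i = w l by rewrite mxE eqxx.
have B'I l i' : i' \in I :\ i ->
    B' l i' = (if l == j then 0 else B l i') - w l * r i'.
  by rewrite !inE mxE => /andP[/negbTE->].
have xv i' : i' \in I -> \sum_(l in J) x i' l * v l = (i' == i)%:R * s.
  have [->|ni] := eqVneq i' i; first by rewrite vi mul1r.
  by move=> i'I; rewrite vI ?mul0r // !inE ni.
(* Away from column [j], the correction by [r] cancels the contribution of row [i], and what remains
   is the left inverse property of [B]. *)
have B'xJ l l' : l \in J -> l' \in J :\ j ->
    \sum_(i' in I) B' l i' * x i' l' = (l == l')%:R.
  move=> lJ l'J; rewrite (big_setD1 i) //= B'i.
  under eq_bigr => i' i'I do rewrite (B'I _ _ i'I) mulrBl -mulrA.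
  rewrite sumrB. rewrite -mulr_sumr.
  have -> : \sum_(i' in I :\ i) r i' * x i' l' = x i l'.
    under eq_bigr do rewrite mulr_suml.
    rewrite exchange_big /= (bigD1 l') //= [X in _ + X]big1 => [|h /andP[hJ nh]].
      under eq_bigr do rewrite -mulrA.
      by rewrite -mulr_sumr Bx // eqxx mulr1 addr0.
    under eq_bigr do rewrite -mulrA.
    by rewrite -mulr_sumr Bx // (negbTE nh) mulr0.
  rewrite addrCA subrr addr0.
  have [->|nl] := eqVneq l j.
    rewrite big1 => [|h _]; last by rewrite mul0r.
    by move: l'J; rewrite !inE eq_sym => /andP[/negbTE->].
  by rewrite Bx // !inE nl.
exists B'; split=> [i1 i2 i1I i2I|l l' lJ l'J].
- have [->|ni2] := eqVneq i2 i.
    under eq_bigr do rewrite B'i /w mulrA.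
    by rewrite -mulr_suml xv // mulrK.
  have i2I' : i2 \in I :\ i by rewrite !inE ni2.
  under eq_bigr => l _ do rewrite (B'I _ _ i2I') mulrBr /w !mulrA.
  rewrite sumrB -!mulr_suml xv // mulrK // (big_setD1 j) //= eqxx mulr0 add0r.
  have -> : \sum_(l in J :\ j) x i1 l * (if l == j then 0 else B l i2)
          = \sum_(l in J :\ j) x i1 l * B l i2.
    by apply: eq_bigr => l; rewrite !inE => /andP[/negbTE->].
  have [->|ni1] := eqVneq i1 i.
    by rewrite mul1r subrr eq_sym (negbTE ni2).
  by rewrite mul0r subr0 xB // !inE ni1.
- have [->|nl'] := eqVneq l' j; last by apply: B'xJ; rewrite // !inE nl'.
  (* [x e_j = s e_i - x v'], where [v = e_j + v'] *)
  have xj i' : i' \in I ->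
      x i' j = (i' == i)%:R * s - \sum_(h in J :\ j) x i' h * v h.
    by move=> i'I; rewrite -xv // (big_setD1 j) //= vj mulr1 addrK.
  under eq_bigr => i' i'I do rewrite (xj _ i'I) mulrBr mulr_sumr.
  rewrite sumrB exchange_big /=.
  under [X in _ - X]eq_bigr => h hJ.
    under eq_bigr do rewrite mulrA.
    rewrite -mulr_suml B'xJ //.
  over.
  rewrite (bigD1 i) //= eqxx mul1r B'i /w divrK // big1 => [|i' /andP[_ /negbTE->]];
    last by rewrite mul0r mulr0.
  rewrite addr0; have [->|nl] := eqVneq l j.
    rewrite big1 ?subr0 // => h; rewrite !inE eq_sym => /andP[/negbTE->] _.
    by rewrite mul0r.
  rewrite (big_setD1 l) ?inE ?nl //= eqxx mul1r big1 ?addr0 ?subrr // => h.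
  by rewrite !inE eq_sym => /andP[/negbTE->] _; rewrite mul0r.
Qed.

End SubmatrixInverse.

(** * The factors $x^{(m)}$ and the inverses of their products *)

Section ElementaryProducts.

Set Implicit Arguments.
Unset Strict Implicit.

(** The product $P$ of the factors after the first satisfies $Pe_m=e_m$, so peeling off $1+e_m$
    leaves $(1+e_m)(1-e_m)=1$. *)
Lemma prod_1D_superdiag (R : pzRingType) (e : nat -> R) (m n : nat) :
  (forall k j, (j <= k)%N -> e k * e j = 0) ->
  (\prod_(m <= k < n) (1 + e k)) * (1 - \sum_(m <= k < n) e k) = 1.
Proof.
move=> ee; have prod_e a j : (j <= a)%N -> (\prod_(a <= k < n) (1 + e k)) * e j = e j.
  rewrite big_nat => ja; elim/big_rec: _ => [|k P /andP[ak _] IH]; first by rewrite mul1r.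
  by rewrite -mulrA IH mulrDl mul1r ee ?addr0 // (leq_trans ja).
move dE: (n - m)%N => d; elim: d m dE => [|d IH] m dE.
  by rewrite !big_geq ?subr0 ?mul1r // -subn_eq0 dE.
have mn : (m < n)%N by rewrite -subn_gt0 dE.
rewrite !(big_ltn mn) -mulrA opprD [- e m + _]addrC addrA mulrDr IH; last first.
  by rewrite subnS dE.
by rewrite mulrN prod_e // mulrDl mul1r mulrBr mulr1 ee // subr0 subrK.
Qed.

Variables (F : unitRingType) (n : nat).
Implicit Types (t : nat -> nat -> F) (i j : 'I_n).

(** This is $\sum_{k\ge m}t_{m,k}E_{k,k+1}$: the 1-based column $k+1$ is the ordinal [j] of value
    $k$, whence [t m j]. *)
Definition superdiag t (m : nat) : 'M[F]_n :=
  \matrix_(i, j) if (j == i.+1 :> nat) && (m <= j)%N then t m j else 0.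

Lemma x_row_mul_bidiagonal t m : x_row n t m * (1 - superdiag t m) = 1.
Proof.
pose e k : 'M[F]_n := t m k *: matrix_unit F n k k.+1.
have ee (k j : nat) : (j <= k)%N -> e k * e j = 0.
  move=> jk; apply/matrixP=> a b; rewrite !mxE big1 // => c _; rewrite !mxE.
  case: eqP => [_|]; last by rewrite mulr0 mul0r.
  case: eqP => [[ck]|]; last by rewrite mulr0 mul0r.
  by case: eqP => [cj|]; rewrite ?mulr0 //; move: jk; rewrite -cj ck ltnn.
have -> : superdiag t m = \sum_(m <= k < n) e k.
  apply/matrixP=> a b; rewrite summxE mxE.
  under eq_bigr do rewrite !mxE.
  case: ifP => [/andP[/eqP ba mb]|H].
    rewrite (bigD1_seq (nat_of_ord b)) ?iota_uniq //=; last by rewrite mem_index_iota mb ltn_ord.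
    rewrite -ba !eqxx mulr1 big1 ?addr0 // => k /negbTE nk.
    by rewrite eq_sym nk mulr0.
  rewrite big_nat big1 // => k /andP[mk _].
  case: eqP => [ak|]; last by rewrite mulr0.
  case: eqP => [[bk]|]; last by rewrite mulr0.
  by move: H; rewrite bk ak eqxx mk.
exact: prod_1D_superdiag.
Qed.

Lemma x_row_recr t m i j :
  x_row n t m i j = (i == j)%:R + \sum_l x_row n t m i l * superdiag t m l j.
Proof.
have /matrixP/(_ i j) := x_row_mul_bidiagonal t m.
rewrite mulrBr mulr1 !mxE => /eqP; rewrite subr_eq => /eqP.
by [].
Qed.

Lemma x_row_col_le t m i j : (j < m)%N -> x_row n t m i j = (i == j)%:R.
Proof.
move=> jm; rewrite x_row_recr big1 ?addr0 // => l _.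
by rewrite mxE leqNgt jm andbF mulr0.
Qed.

Lemma x_row_succ t m i j j' : j' = j.+1 :> nat -> (m <= j')%N ->
  x_row n t m i j' = (i == j')%:R + x_row n t m i j * t m j'.
Proof.
move=> j'E mj'; rewrite x_row_recr; congr (_ + _).
rewrite (bigD1 j) //= mxE -j'E eqxx mj' big1 ?addr0 // => l nl.
rewrite mxE j'E eqSS eq_sym (inj_eq val_inj) (negbTE nl) mulr0 //.
Qed.

Lemma x_row_row_lt t m i j : (i.+1 < m)%N -> x_row n t m i j = (i == j)%:R.
Proof.
move=> im; case: j => j; elim: j => [|j IH] jn.
  by rewrite x_row_col_le //=; apply: leq_trans im.
have [?|mj] := ltnP j.+1 m; first by rewrite x_row_col_le.
rewrite (@x_row_succ t m i (Ordinal (ltnW jn))) // IH -!(inj_eq val_inj) /=.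
case: (i =P j :> nat) => [ij|]; last by rewrite mul0r addr0.
by move: (leq_trans im mj); rewrite ij ltnn.
Qed.

(** Along row $m$ of $x^{(m)}$, starting from the diagonal entry 1, each step to the right
    multiplies by the next $t_{m,k}$. *)
Lemma x_row_head_unit t m i j : (i <= j)%N -> m = i.+1 ->
  (forall k, (m <= k < n)%N -> t m k \is a GRing.unit) ->
  x_row n t m i j \is a GRing.unit.
Proof.
move=> ij mE Ut; case: j ij => j; elim: j => [|j IH] jn /=.
  rewrite leqn0 => /eqP i0; rewrite x_row_col_le ?mE // -(inj_eq val_inj) /= i0.
  exact: unitr1.
rewrite leq_eqVlt => /orP[/eqP ij|ij].
  by rewrite x_row_col_le ?mE /= ?ij // -(inj_eq val_inj) /= ij eqxx unitr1.
rewrite (@x_row_succ t m i (Ordinal (ltnW jn))) ?mE // -(inj_eq val_inj) /=.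
rewrite ltn_eqF // add0r -mE unitrMl ?IH // Ut // mE jn andbT //.
Qed.

Definition x_rows t (a b : nat) : 'M[F]_n :=
  \prod_(m <- rev (index_iota a b)) x_row n t m.

Lemma x_rows_cat t a b c : (a <= b <= c)%N -> x_rows t a c = x_rows t b c * x_rows t a b.
Proof.
move=> /andP[ab bc]; rewrite /x_rows -big_cat -rev_cat; congr (\big[_/_]_(i <- rev _) _).
by rewrite /index_iota -[in iota b _](subnKC ab) -iotaD; congr iota; lia.
Qed.

Lemma x_rows_row_lt t a b i j : (i.+1 < a)%N -> x_rows t a b i j = (i == j)%:R.
Proof.
move=> ia; rewrite /x_rows big_seq; move: j.
elim/big_rec: _ => [|m P]; first by move=> j; rewrite !mxE.
rewrite mem_rev mem_index_iota => /andP[am _] IH j; rewrite mxE (bigD1 i) //=.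
rewrite IH x_row_row_lt ?eqxx ?mul1r ?(leq_trans ia) // big1 ?addr0 // => l nl.
by rewrite x_row_row_lt ?(leq_trans ia) // eq_sym (negbTE nl) mul0r.
Qed.

(* The inverse is a product of [a] bidiagonal factors, hence banded. *)
Lemma x_rows_banded_inverse t a : exists Z : 'M[F]_n,
  [/\ x_rows t 1 a.+1 * Z = 1, forall i, Z i i = 1
    & forall i j, ~~ (j <= i + a <= j + a)%N -> Z i j = 0].
Proof.
elim: a => [|a [Z [YZ Z1 Z0]]].
  exists 1; rewrite /x_rows big_nil mul1r; split=> // [i|i j]; rewrite mxE ?eqxx //.
  by case: eqP => [->|//]; rewrite !addn0 leqnn.
exists (Z * (1 - superdiag t a.+1)); split=> [|i|i j ij].
- rewrite (@x_rows_cat _ _ a.+1) ?ltnS ?leqnSn //.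
  have -> : x_rows t a.+1 a.+2 = x_row n t a.+1.
    by rewrite /x_rows /index_iota subSn // subnn big_seq1.
  rewrite -mulrA [X in _ * X]mulrA YZ mul1r; exact: x_row_mul_bidiagonal.
- rewrite mulrBr mulr1 !mxE Z1 big1 ?subr0 // => l _; rewrite mxE.
  case: ifP => [/andP[/eqP il _]|]; last by rewrite mulr0.
  by rewrite Z0 ?mul0r // il; lia.
- rewrite mulrBr mulr1 !mxE Z0 ?sub0r; last by lia.
  rewrite big1 ?oppr0 // => l _; rewrite mxE.
  case: ifP => [/andP[/eqP jl _]|]; last by rewrite mulr0.
  by rewrite Z0 ?mul0r //; lia.
Qed.

End ElementaryProducts.

(** * Lower triangularity and unit diagonal of $x_-$ *)

Section LowerTriangular.

Set Implicit Arguments.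
Unset Strict Implicit.

Variables (F : unitRingType) (n : nat).
Hypothesis skew_field : forall a : F, a != 0 -> a \is a GRing.unit.
Implicit Types (c : 'M[F]_n) (i j : 'I_n).

Lemma lower_borel_diag_unit c i : lower_borel c -> c i i \is a GRing.unit.
Proof.
case=> [[b [cb _]] /is_trig_mxP c0].
(* The induction must also carry the lower triangularity of the inverse [b]: it reduces row [i] of
   [c *m b = 1], on and right of the diagonal, to the single term [c i i * b i j]. *)
suff H k : forall i, i = k :> nat ->
    c i i \is a GRing.unit /\ forall j, (i < j)%N -> b i j = 0 by case: (H i i).
elim/ltn_ind: k {i} => k IH i ik.
have row j : (i <= j)%N -> c i i * b i j = (i == j)%:R.
  move=> ij; have /matrixP/(_ i j) := cb; rewrite !mxE => <-.
  rewrite (bigD1 i) //= big1 ?addr0 // => l nl.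
  have [il|li|/val_inj il] := ltngtP i l; first by rewrite c0 ?mul0r.
    rewrite (IH l _ l _).2 ?mulr0 -?ik //; exact: leq_trans ij.
  by rewrite il eqxx in nl.
have Ucii : c i i \is a GRing.unit.
  apply: skew_field; apply/eqP=> cii; have := row i (leqnn _).
  by rewrite cii mul0r eqxx => /eqP; rewrite eq_sym oner_eq0.
split=> // j ij; apply: (mulrI Ucii); rewrite row ?(ltnW ij) // mulr0.
by rewrite -(inj_eq val_inj) ltn_eqF.
Qed.

(** The second half of the cell condition gives $x_-\in B^-eB^-=B^-$. *)
Lemma double_bruhat_1_lower u c : double_bruhat u 1%g c ->
  (forall i j, (i < j)%N -> c i j = 0) /\ (forall i, c i i \is a GRing.unit).
Proof.
case=> _ [c1 [c2 [Lc1 Lc2 ->]]].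
have -> : perm_matrix F 1 = 1%:M :> 'M_n by apply/matrixP=> i j; rewrite !mxE perm1.
rewrite mulmx1.
have [/is_trig_mxP c1_0 /is_trig_mxP c2_0] := (Lc1.2, Lc2.2).
have c12_0 i j l : (i <= j)%N -> (l != i) || (l != j) -> c1 i l * c2 l j = 0.
  move=> ij nl; have [il|li] := ltnP i l; first by rewrite c1_0 ?mul0r.
  rewrite c2_0 ?mulr0 //; move: nl; rewrite -!(inj_eq val_inj) /=; lia.
split=> [i j ij|i]; rewrite mxE.
  rewrite big1 // => l _; rewrite c12_0 ?(ltnW ij) //.
  by rewrite -!(inj_eq val_inj) /=; lia.
rewrite (bigD1 i) //= big1 ?addr0 => [|l nl]; last by rewrite c12_0 ?nl.
by rewrite unitrMl; apply: lower_borel_diag_unit.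
Qed.

End LowerTriangular.

(** * Quasiminors of the factored matrix *)

Section Factorization.

Set Implicit Arguments.
Unset Strict Implicit.

Variables (F : unitRingType) (n : nat) (x c : 'M[F]_n) (t : nat -> nat -> F).
Hypothesis c_lower : forall i j : 'I_n, (i < j)%N -> c i j = 0.
Hypothesis c_unit : forall i : 'I_n, c i i \is a GRing.unit.
Hypothesis t_unit : forall m k : nat, (1 <= m <= k)%N -> (k < n)%N ->
  t m k \is a GRing.unit.
Hypothesis x_fact : x = c * x_rows n t 1 n.
Implicit Types i j : 'I_n.

(** With $m=i+1$ and $k=j+1$, this is the value $(x_-)_{mm}(x^{(m)})_{mk}$ to be found for the
    quasiminor. *)
Definition fact_quasidet i j : F := c i i * x_row n t i.+1 i j.

Lemma fact_quasidet_unit i j : (i <= j)%N -> fact_quasidet i j \is a GRing.unit.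
Proof.
move=> ij; rewrite unitrMl // (x_row_head_unit ij) // => k /andP[ik kn].
exact: t_unit.
Qed.

Lemma fact_quasidet_succ i j j' : (i <= j)%N -> j' = j.+1 :> nat ->
  fact_quasidet i j' = fact_quasidet i j * t i.+1 j'.
Proof.
move=> ij j'E; rewrite /fact_quasidet (x_row_succ _ _ j'E) ?j'E ?ltnS // -mulrA.
by rewrite -(inj_eq val_inj) /= j'E ltn_eqF ?ltnS // add0r.
Qed.

Lemma in_itv1 a b j : (j \in itv1 n a b) = (a <= j.+1 <= b)%N.
Proof. by rewrite inE. Qed.

(* Witness: column [j] of the inverse of [x^(m-1) ... x^(1)], with [m = i + 1]. *)
Lemma fact_quasidet_witness i j : (i <= j)%N ->
  exists v, quasidet_witness x (itv1 n 1 i.+1) (itv1 n (j - i).+1 j.+1) i j v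
              (fact_quasidet i j).
Proof.
move=> ij; have [Z [YZ Z1 Z0]] := x_rows_banded_inverse n t i.
(* The range is extended to [n.+1] by the empty factor $x^{(n)}=1$, so that the splitting also makes
   sense for $i=n-1$. *)
have xE : x = c * (x_rows n t i.+2 n.+1 * (x_row n t i.+1 * x_rows n t 1 i.+1)).
  have -> : x_row n t i.+1 = x_rows n t i.+1 i.+2.
    by rewrite /x_rows /index_iota subSn // subnn big_seq1.
  rewrite -!x_rows_cat ?ltnS ?leqnSn ?ltn_ord //= x_fact; congr (_ * _).
  rewrite (@x_rows_cat _ _ _ 1 n n.+1) ?leqnSn ?andbT; last exact: leq_ltn_trans (ltn_ord i).
  by rewrite [x_rows n t n n.+1]/x_rows /index_iota subSn // subnn big_seq1
     /x_row big_geq // mul1r.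
have xZ i' : (i' <= i)%N ->
    \sum_(l in itv1 n (j - i).+1 j.+1) x i' l * Z l j = (i' == i)%:R * fact_quasidet i j.
  move=> i'i; transitivity ((x * Z) i' j).
    rewrite mxE big_mkcond; apply: eq_bigr => l _; rewrite in_itv1.
    by case: ifP => // lJ; rewrite Z0 ?mulr0 //; lia.
  (* Only the diagonal term of [c] survives: entries right of it vanish, and for $l<i'\le i$ row [l]
     of the remaining factors is that of the identity, which is 0 in column $j\ge i$. *)
  rewrite xE -!mulrA YZ mulr1 mxE (bigD1 i') //= big1 ?addr0 => [|l nl].
    rewrite mxE (bigD1 i') //= big1 ?addr0 => [|l nl].
      rewrite x_rows_row_lt ?ltnS // eqxx mul1r.
      have [->|ni] := eqVneq i' i; first by rewrite mul1r.
      have lti : (i' < i)%N by rewrite ltn_neqAle i'i andbT.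
      rewrite mul0r x_row_row_lt ?ltnS // -(inj_eq val_inj) ltn_eqF ?mulr0 //.
      exact: leq_trans ij.
    by rewrite x_rows_row_lt ?ltnS // eq_sym (negbTE nl) mul0r.
  have [il|li|/val_inj il] := ltngtP i' l; first by rewrite c_lower ?mul0r.
    rewrite mxE big1 ?mulr0 // => h _.
    have lti : (l < i)%N by exact: leq_trans i'i.
    rewrite x_rows_row_lt ?ltnS ?(ltnW lti) //.
    case: eqP => [<-|]; last by rewrite mul0r.
    rewrite x_row_row_lt ?ltnS // -(inj_eq val_inj) ltn_eqF ?mulr0 //.
    exact: leq_trans ij.
  by rewrite il eqxx in nl.
exists (fun l => Z l j); split=> [//||i'].
  by rewrite xZ // eqxx mul1r.
rewrite in_setD1 in_itv1 => /andP[ni i'i].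
by rewrite xZ ?(negbTE ni) ?mul0r //; lia.
Qed.

Lemma itv1_D1_row i : itv1 n 1 i.+1 :\ i = itv1 n 1 i.
Proof.
by apply/setP=> l; rewrite in_setD1 !in_itv1 -(inj_eq val_inj) /=; lia.
Qed.

Lemma itv1_D1_col a j : itv1 n a j.+1 :\ j = itv1 n a j.
Proof.
by apply/setP=> l; rewrite in_setD1 !in_itv1 -(inj_eq val_inj) /=; lia.
Qed.

(** Deleting row $m$ and column $k$ yields the same configuration for $(m-1,k-1)$, as $k-m$ is
    unchanged; the Schur complement for putting them back is the unit [fact_quasidet]. *)
Lemma fact_inverse_on m k : (m <= k <= n)%N ->
  exists B, inverse_on x (itv1 n 1 m) (itv1 n (k - m).+1 k) B.
Proof.
elim: m k => [|m IH] k /andP[mk kn].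
  exists 0; split=> i j; rewrite in_itv1; lia.
case: k mk kn => // k mk kn.
pose i := Ordinal (leq_trans mk kn); pose j := Ordinal kn.
have [|B invB] := IH k; first by lia.
have [v vw] := @fact_quasidet_witness i j mk.
rewrite subSS; apply: (@inverse_on_extend _ _ x _ _ i j B v (fact_quasidet i j)) => //.
- by rewrite in_itv1 /=; lia.
- by rewrite in_itv1 /=; lia.
- by rewrite (itv1_D1_row i) (itv1_D1_col _ j).
- exact: fact_quasidet_unit.
Qed.

Lemma card_itv1 a b : (b <= n)%N -> #|itv1 n a.+1 b| = (b - a)%N.
Proof.
elim: b => [|b IH] bn; first by apply: eq_card0 => l; rewrite !inE; lia.
have [ab|ba] := leqP a b.
  rewrite (cardsD1 (Ordinal bn)) (itv1_D1_col _ (Ordinal bn)) IH ?(ltnW bn) //.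
  by rewrite in_itv1 /=; lia.
by rewrite eq_card0 => [|l]; rewrite ?inE; lia.
Qed.

Lemma fact_quasidet_defined i j : (i <= j)%N ->
  quasidet_defined x (itv1 n 1 i.+1) (itv1 n (j - i).+1 j.+1) i j.
Proof.
move=> ij; split; rewrite ?in_itv1 ?card_itv1 ?ltn_ord //; try by lia.
right; rewrite itv1_D1_row itv1_D1_col.
have [|B /inverse_on_mx_inverse invB] := @fact_inverse_on i j; last by eexists; exact: invB.
by rewrite ij ltnW.
Qed.

Lemma fact_quasiminorE i j : (i <= j)%N ->
  quasiminor x (itv1 n 1 i.+1) (itv1 n (j - i).+1 j.+1) i j = fact_quasidet i j.
Proof.
move=> ij; have [iI jJ IJ _] := fact_quasidet_defined ij.
(* The marked row and column are the last ones of their intervals, so the sign is trivial. *)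
have gr a (l : 'I_n) : num_greater (itv1 n a l.+1) l = 0%N.
  by apply: eq_card0 => h; rewrite !inE; lia.
rewrite /quasiminor !gr expr0 mul1r.
have [v vw] := fact_quasidet_witness ij.
have [|B invB] := @fact_inverse_on i j; first by rewrite ij ltnW.
apply: (@quasidet_witness_eq _ _ _ _ _ i j B v) => //.
by rewrite itv1_D1_row itv1_D1_col.
Qed.

End Factorization.

Theorem lemma5p1 (F : unitRingType)
    (skew_field : forall a : F, a != 0 -> a \is a GRing.unit)
    (n : nat) (u : 'S_n) (x x_minus : 'M[F]_n) (t : nat -> nat -> F)
    (x_cell : double_bruhat u (w_longest n) x)
    (x_minus_cell : double_bruhat u 1%g x_minus)
    (t_neq0 : forall m k : nat, (1 <= m <= k)%N -> (k <= n.-1)%N -> t m k != 0)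
    (x_fact : x = x_minus * \prod_(m <- rev (index_iota 1 n)) x_row n t m)
    (m k : nat) (hmk : (1 <= m <= k)%N) (hk : (k <= n.-1)%N)
    (* The ordinals for the 1-based indices m, k and k + 1. *)
    (om ok ok1 : 'I_n)
    (def_om : om.+1 = m) (def_ok : ok.+1 = k) (def_ok1 : ok1.+1 = k.+1) :
  let I := itv1 n 1 m in
  let J := itv1 n (k - m + 1)%N k in
  let J1 := itv1 n (k - m + 2)%N (k + 1)%N in
  [/\ quasidet_defined x I J om ok,
      quasidet_defined x I J1 om ok1,
      quasiminor x I J om ok \is a GRing.unit
    & t m k = (quasiminor x I J om ok)^-1 * quasiminor x I J1 om ok1].
Proof.
have [c_lower c_unit] := double_bruhat_1_lower skew_field x_minus_cell.
have t_unit m' k' : (1 <= m' <= k')%N -> (k' < n)%N -> t m' k' \is a GRing.unit.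
  by move=> mk' kn; apply/skew_field/t_neq0 => //; lia.
have xE : x = x_minus * x_rows n t 1 n := x_fact.
have ij : (om <= ok)%N by lia.
have ij1 : (om <= ok1)%N by lia.
move=> I J J1.
have IE : I = itv1 n 1 om.+1 by rewrite /I def_om.
have JE : J = itv1 n (ok - om).+1 ok.+1 by rewrite /J; congr itv1; lia.
have J1E : J1 = itv1 n (ok1 - om).+1 ok1.+1 by rewrite /J1; congr itv1; lia.
have Uq := fact_quasidet_unit c_unit t_unit ij.
rewrite IE JE J1E !(fact_quasiminorE c_lower c_unit t_unit xE) //.
split=> //; try exact: (fact_quasidet_defined c_lower c_unit t_unit xE).
have ok1E : ok1 = ok.+1 :> nat by lia.
(* The two quasiminors are $q$ and $q\,t_{m,k}$ with the same unit $q$, which cancels on the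
   left. *)
rewrite (fact_quasidet_succ _ _ ij ok1E) mulKr //.
by rewrite def_om; congr t; lia.
Qed.
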